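(* Let $F:\mathbb{R}^d_{\geq}\to\mathbb{R}^d$ be block-constant on $\mathbb{R}^d_{\geq}$ and Lipschitz continuous. Then for all $A,B\in\mathbb{H}_d$, $$\|\mathcal{L}_F(A)-\mathcal{L}_F(B)\|_2\leq \|F\|_{Lip}\,\|A-B\|_2.$$
   Context: $\mathbb{H}_d$ is the space of Hermitian $d\times d$ complex matrices; for matrices $\|\cdot\|_2$ is the Frobenius norm, for vectors the Euclidean norm. $\mathbb{R}^d_{\geq}$ is the set of $x\in\mathbb{R}^d$ with $x_1\geq\dots\geq x_d$. $F$ is block-constant on $\mathbb{R}^d_\geq$ if for every $x\in\mathbb{R}^d_\geq$, $F_m(x)=F_n(x)$ whenever $x_m=x_n$. For $A\in\mathbb{H}_d$ with spectral decomposition $A=U_A\Lambda_\alpha U_A^*$ ($U_A$ unitary, $\alpha\in\mathbb{R}^d_\geq$ the non-increasingly ordered eigenvalues with multiplicity, $\Lambda_v$ the diagonal matrix with diagonal $v$), define $\mathcal{L}_F(A)=U_A\Lambda_{F(\alpha)}U_A^*$, which is independent of the choice of $U_A$. The Lipschitz constant is $\|F\|_{Lip}=\sup_{x\neq y}\frac{\|F(x)-F(y)\|_2}{\|x-y\|_2}$, the supremum over $x,y$ in the domain $\mathbb{R}^d_\geq$ of $F$. *)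

(* Defs.v *)
From mathcomp Require Import all_boot all_order all_fingroup all_algebra.
From mathcomp Require Import complex.
From mathcomp Require Import boolp classical_sets reals.
From mathcomp Require Import sesquilinear spectral.

Set Implicit Arguments.
Unset Strict Implicit.
Unset Printing Implicit Defensive.

Import Order.TTheory GRing.Theory Num.Theory.
Local Open Scope ring_scope.
Local Open Scope sesquilinear_scope.
Local Open Scope classical_set_scope.

Definition nonincreasing_vec (R : realType) (d : nat) (x : 'rV[R]_d) : bool :=
  [forall i : 'I_d, forall j : 'I_d, (i <= j)%N ==> (x 0 j <= x 0 i)].

Definition ordvec (R : realType) (d : nat) : Type :=
  {x : 'rV[R]_d | nonincreasing_vec x}.

Definition block_constant (R : realType) (d : nat)
    (F : ordvec R d -> 'rV[R]_d) : Prop :=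
  forall (x : ordvec R d) (m n : 'I_d),
    val x 0 m = val x 0 n -> F x 0 m = F x 0 n.

(* The norm that MathComp-Analysis puts on matrices is the sup norm, so the
   Euclidean and Frobenius norms are defined here; Normc.normc is the modulus
   R[i] -> R. *)
Definition euclidean_norm (R : realType) (d : nat) (x : 'rV[R]_d) : R :=
  Num.sqrt (\sum_(i < d) x 0 i ^+ 2).

Definition frobenius_norm (R : realType) (m n : nat) (A : 'M[R[i]]_(m, n)) : R :=
  Num.sqrt (\sum_(i < m) \sum_(j < n) Normc.normc (A i j) ^+ 2).

Definition lipschitz_continuous (R : realType) (d : nat)
    (F : ordvec R d -> 'rV[R]_d) : Prop :=
  exists K : R, forall x y : ordvec R d,
    euclidean_norm (F x - F y) <= K * euclidean_norm (val x - val y).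

(* [sup] is real-valued: it is the least upper bound when F is Lipschitz
   continuous and d > 0; for d = 0 the set is empty and [sup set0 = 0]. *)
Definition lip_const (R : realType) (d : nat)
    (F : ordvec R d -> 'rV[R]_d) : R :=
  sup [set r : R | exists x y : ordvec R d, val x <> val y /\
    r = euclidean_norm (F x - F y) / euclidean_norm (val x - val y)].

Definition diagC (R : realType) (d : nat) (v : 'rV[R]_d) : 'M[R[i]]_d :=
  diag_mx (map_mx (real_complex R) v).

Definition spectral_decomposition (R : realType) (d : nat)
    (A U : 'M[R[i]]_d) (alpha : ordvec R d) : Prop :=
  U \is unitarymx /\ A = U *m diagC (val alpha) *m U^t*.

(* The value U Lambda_{F(alpha)} U^* is selected by choice among those given by
   all ordered spectral decompositions of A (0 if A has none). For Hermitian A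
   a decomposition exists (spectral_decomposition_exists), and for
   block-constant F the value does not depend on it (spectral_liftE). *)
Definition spectral_lift (R : realType) (d : nat)
    (F : ordvec R d -> 'rV[R]_d) (A : 'M[R[i]]_d) : 'M[R[i]]_d :=
  xget 0 [set M : 'M[R[i]]_d | exists (U : 'M[R[i]]_d) (alpha : ordvec R d),
    spectral_decomposition A U alpha /\ M = U *m diagC (F alpha) *m U^t*].

Lemma nonincreasing_vecP (R : realType) (d : nat) (x : 'rV[R]_d) :
  reflect (forall i j : 'I_d, (i <= j)%N -> x 0 j <= x 0 i)
          (nonincreasing_vec x).
Proof.
apply: (iffP forallP) => [h i j ij|h i].
  by have /forallP/(_ j)/implyP := h i; exact.
by apply/forallP => j; apply/implyP => /h.
Qed.

Lemma spectral_decomposition_exists (R : realType) (d : nat) (A : 'M[R[i]]_d) :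
  A \is hermsymmx ->
  exists (U : 'M[R[i]]_d) (alpha : ordvec R d), spectral_decomposition A U alpha.
Proof.
move=> hA.
have /orthomx_spectralP eA := hermitian_normalmx hA.
have uP := spectral_unitarymx A.
have /mxOverP rD := hermitian_spectral_diag_real hA.
rewrite invmx_unitary // in eA.
set P := spectralmx A in eA uP; set D := spectral_diag A in eA rD.
pose t := [tuple complex.Re (D 0 i) | i < d].
have geT : total (fun x y : R => x >= y) by move=> x y; exact: le_total.
have geTr : transitive (fun x y : R => x >= y).
  by move=> y x z /= xy yz; exact: le_trans yz xy.
pose s := sort (fun x y : R => x >= y) t.
have /tuple_permP[p ep] : perm_eq s t by rewrite perm_sort.
have ss : size s = d by rewrite size_sort size_tuple.
pose a : 'rV[R]_d := \row_i complex.Re (D 0 (p i)).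
have ae i : a 0 i = nth 0 s i.
  have hi : (i < size s)%N by rewrite ss.
  rewrite mxE ep (nth_map i) ?size_enum_ord //.
  by rewrite nth_ord_enum tnth_mktuple.
have na : nonincreasing_vec a.
  apply/nonincreasing_vecP => i j ij; rewrite !ae.
  have := sort_sorted geT t; rewrite -/s => so.
  have hrefl : reflexive (fun x y : R => x >= y) by move=> x; exact: lexx.
  by apply: (sorted_leq_nth geTr hrefl 0 so) => //; rewrite inE ss.
exists (col_perm p (P^t*)), (exist _ a na); split.
  apply/unitarymxP; apply/matrixP => i k.
  have /matrixP/(_ i k) <- : P^t* *m P = 1%:M.
    by rewrite -invmx_unitary // mulVmx // unitarymx_unit.
  rewrite !mxE [RHS](reindex_perm p) /=.
  by apply: eq_bigr => j _; rewrite !mxE conjCK.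
rewrite {1}eA; apply/matrixP => i k.
rewrite /diagC !mul_mx_diag !mxE (reindex_perm p) /=.
by apply: eq_bigr => j _; rewrite !mxE conjCK RRe_real.
Qed.

Lemma spectral_decomposition_unique (R : realType) (d : nat)
    (A U V : 'M[R[i]]_d) (alpha beta : ordvec R d) :
  spectral_decomposition A U alpha -> spectral_decomposition A V beta ->
  val alpha = val beta.
Proof.
have charE (W : 'M[R[i]]_d) (g : ordvec R d) : spectral_decomposition A W g ->
    char_poly A =
    \prod_(x <- [seq ((val g 0 i)%:C)%C | i <- enum 'I_d]) ('X - x%:P).
  move=> [uW ->]; rewrite big_map big_enum /=.
  rewrite -[in LHS]invmx_unitary //.
  have uW1 := unitarymx_unit uW.
  set D := diagC _.
  have -> : char_poly (W *m D *m invmx W) = char_poly D.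
    rewrite /char_poly /char_poly_mx.
    have -> : 'X%:M - map_mx polyC (W *m D *m invmx W) =
        map_mx polyC W *m ('X%:M - map_mx polyC D) *m map_mx polyC (invmx W).
      rewrite mulmxBr mulmxBl !map_mxM; congr (_ - _).
      by rewrite scalar_mxC -mulmxA -map_mxM mulmxV // map_mx1 mulmx1.
    rewrite !det_mulmx mulrAC -det_mulmx -map_mxM mulmxV // map_mx1 det1.
    by rewrite mul1r.
  rewrite char_poly_trig ?diag_mx_is_trig //.
  by apply: eq_bigr => i _; rewrite !mxE eqxx mulr1n.
move=> /charE eU /charE; rewrite eU => /prod_XsubC_eq.
move=> /(perm_map (@complex.Re R)); rewrite -2!(map_comp (@complex.Re R)) => h.
have geTr : transitive (fun x y : R => x >= y).
  by move=> y x z /= xy yz; exact: le_trans yz xy.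
have so (g : ordvec R d) :
    sorted (fun x y : R => x >= y) [seq val g 0 i | i <- enum 'I_d].
  have /nonincreasing_vecP hg := valP g.
  rewrite sorted_map; apply: (@sub_sorted _ (fun i j : 'I_d => (i <= j)%N)).
    by move=> i j /= /hg.
  rewrite -(@sorted_map _ _ (@nat_of_ord d) leq) val_enum_ord.
  exact: iota_sorted.
have anti : antisymmetric (fun x y : R => x >= y).
  by move=> x y /= /andP[xy yx]; apply/eqP; rewrite eq_le xy yx.
have e := sorted_eq geTr anti (so alpha) (so beta) h.
apply/rowP => i; move/eq_in_map: e => /(_ i); apply.
by rewrite mem_enum.
Qed.

Lemma spectral_liftE (R : realType) (d : nat) (F : ordvec R d -> 'rV[R]_d)
    (A U : 'M[R[i]]_d) (alpha : ordvec R d) :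
  block_constant F -> spectral_decomposition A U alpha ->
  spectral_lift F A = U *m diagC (F alpha) *m U^t*.
Proof.
move=> bF hU; rewrite /spectral_lift; case: xgetP => [M _|/(_ _)]; last first.
  by case/(_ (U *m diagC (F alpha) *m U^t*)); exists U, alpha.
move=> [V [beta [hV ->]]].
have ab : beta = alpha by apply/val_inj/(spectral_decomposition_unique hV hU).
case: hU => uU eU; case: hV => uV eV; rewrite ab in eV *.
have uU1 : U^t* *m U = 1%:M.
  by rewrite -invmx_unitary // mulVmx // unitarymx_unit.
have uV1 : V^t* *m V = 1%:M.
  by rewrite -invmx_unitary // mulVmx // unitarymx_unit.
have /unitarymxP uV2 := uV; have /unitarymxP uU2 := uU.
pose W := U^t* *m V.
have cW : W *m diagC (val alpha) = diagC (val alpha) *m W.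
  have : U^t* *m A *m V = U^t* *m A *m V by [].
  rewrite {1}eV eU !mulmxA uU1 mul1mx -!mulmxA uV1 mulmx1.
  by rewrite /W !mulmxA.
have cFW : W *m diagC (F alpha) = diagC (F alpha) *m W.
  apply/matrixP => i j; have /matrixP/(_ i j) := cW.
  rewrite /diagC !mul_mx_diag !mul_diag_mx !mxE mulrC => /eqP.
  rewrite -subr_eq0 -mulrBl mulf_eq0 => /orP[|/eqP ->]; last by rewrite mulr0 mul0r.
  rewrite subr_eq0 => /eqP[] /bF ->; exact: mulrC.
have -> : V = U *m W by rewrite /W mulmxA uU2 mul1mx.
have WW : W *m W^t* = 1%:M.
  by rewrite /W trmx_mul map_mxM trmxCK !mulmxA mulmxtVK.
clearbody W; rewrite trmx_mul map_mxM -(mulmxA U W) cFW !mulmxA.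
by rewrite -(mulmxA _ W) WW mulmx1.
Qed.

(* Main.v *)
(** Write A = U Λ_a U* and B = V Λ_b V*, and let s_ij = |(U* V)_ij|^2, a doubly
    stochastic matrix.  Then |A - B|^2 = sum_ij s_ij (a_i - b_j)^2, and likewise
    for the lifted matrices with f = F(a), h = F(b).  Replacing two consecutive
    entries of a by their mean keeps a ordered and makes the corresponding
    entries of F equal, so the Lipschitz bound gives
    |f_p - f_(p+1)| <= L (a_p - a_(p+1)), and similarly for h and b.  Hence
    L^2 a_i b_j - f_i h_j is a Monge array, and summation by parts shows that
    sum_ij s_ij (L^2 a_i b_j - f_i h_j) is largest when s is the identity matrix.
    The claim is thereby reduced to |f - h| <= L |a - b|. *)
Require Import Defs.
From mathcomp Require Import all_boot all_order all_algebra.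
From mathcomp Require Import complex.
From mathcomp Require Import reals.
From mathcomp Require Import sesquilinear spectral.
From mathcomp Require Import boolp classical_sets zify ring lra.

Local Open Scope ring_scope.

Set Implicit Arguments.
Unset Strict Implicit.
Unset Printing Implicit Defensive.

Import Order.TTheory GRing.Theory Num.Theory.

(** * Doubly stochastic matrices and summation by parts *)

Definition doubly_stochastic (R : realType) (d : nat) (S : 'M[R]_d) : Prop :=
  [/\ forall i j, 0 <= S i j, forall i, \sum_j S i j = 1
    & forall j, \sum_i S i j = 1].

Definition step (R : realType) (n : nat) (x : 'rV[R]_n.+1) : 'rV[R]_n :=
  \row_p (x 0 (widen_ord (leqnSn n) p) - x 0 (lift ord0 p)).

(** Row [p] is the indicator of the initial segment 0..p, so [initial_mx R n *m E *m (initial_mx R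
    n)^T] lists the sums of [E] over its leading corners. *)
Definition initial_mx (R : realType) (n : nat) : 'M[R]_(n, n.+1) :=
  \matrix_(p, i) (i <= p)%N%:R.

(** Abel summation: telescoping the steps of index at least i recovers entry i from the last
    entry. *)
Lemma step_initial_mx (R : realType) (n : nat) (x : 'rV[R]_n.+1) :
  x = const_mx (x 0 ord_max) + step x *m initial_mx R n.
Proof.
apply/rowP => i; rewrite !mxE.
pose a k := x 0 (inord k).
transitivity (a n + \sum_(0 <= p < n) (a p - a p.+1) * (i <= p)%N%:R).
  have ian : (i <= n)%N by rewrite -ltnS.
  rewrite (big_cat_nat (n := i)) //= big_nat_cond big1 ?add0r; last first.
    by move=> p /andP[/andP[_ pi] _]; rewrite leqNgt pi mulr0.
  under eq_big_nat => p /andP[-> _] do rewrite mulr1 -opprB.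
  rewrite sumrN telescope_sumr // /a inord_val; ring.
rewrite big_mkord; congr (_ + _).
  by rewrite /a; congr (x 0 _); apply: val_inj; rewrite /= inordK.
apply: eq_bigr => p _; rewrite !mxE /a; congr ((x 0 _ - x 0 _) * _).
  by apply: val_inj; rewrite /= inordK // ltnS ltnW.
by apply: val_inj; rewrite /= inordK // ltnS.
Qed.

(** Zero row and column sums of [E] annihilate the constant parts of [x] and [y], so only their
    steps survive. *)
Lemma bilinear_step (R : realType) (n : nat) (E : 'M[R]_n.+1)
    (x y : 'rV[R]_n.+1) :
  (forall i, \sum_j E i j = 0) -> (forall j, \sum_i E i j = 0) ->
  x *m E *m y^T =
  step x *m (initial_mx R n *m E *m (initial_mx R n)^T) *m (step y)^T.
Proof.
move=> rE cE.
have lE c : (const_mx c : 'rV_n.+1) *m E = 0.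
  apply/rowP => j; rewrite !mxE.
  by under eq_bigr do rewrite mxE; rewrite -mulr_sumr cE mulr0.
have Er c : E *m (const_mx c : 'rV_n.+1)^T = 0.
  apply/colP => i; rewrite !mxE.
  by under eq_bigr do rewrite !mxE; rewrite -mulr_suml rE mul0r.
rewrite {1}(step_initial_mx x) {1}(step_initial_mx y).
by rewrite mulmxDl lE add0r linearD /= mulmxDr -mulmxA -mulmxA Er !mulmx0 add0r
  trmx_mul !mulmxA.
Qed.

(** Sum over the corner along its shorter side: there each row or column of the identity contributes
    exactly 1, that of [S] at most 1. *)
Lemma initial_sums_ge0 (R : realType) (n : nat) (S : 'M[R]_n.+1) (p q : 'I_n) :
  doubly_stochastic S ->
  0 <= (initial_mx R n *m (1%:M - S) *m (initial_mx R n)^T) p q.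
Proof.
move=> [S0 Sr Sc].
have le_part (I : finType) (f : I -> R) (P : pred I) :
    (forall i, 0 <= f i) -> \sum_i f i = 1 ->
    \sum_i f i * (P i)%:R <= 1.
  move=> f0 f1; rewrite -[leRHS]f1; apply: ler_sum => i _; rewrite ler_piMr //.
  by case: (P i); rewrite ?ler01.
case: (leqP p q) => pq.
- rewrite -mulmxA mxE; apply: sumr_ge0 => i _; rewrite [initial_mx _ _ p i]mxE.
  case: leqP => ip; last by rewrite mul0r.
  rewrite mul1r mulmxBl mul1mx !mxE (leq_trans ip pq) subr_ge0.
  under eq_bigr do rewrite !mxE.
  exact: (le_part _ (S i) (fun j : 'I_n.+1 => (j <= q)%N)).
- rewrite mxE; apply: sumr_ge0 => j _; rewrite [_^T _ _]mxE [initial_mx _ _ q j]mxE.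
  case: leqP => jq; last by rewrite mulr0.
  rewrite mulr1 mulmxBr mulmx1 !mxE (leq_trans jq (ltnW pq)) subr_ge0.
  under eq_bigr do rewrite mxE mulrC.
  exact: (le_part _ (S^~ j) (fun i : 'I_n.+1 => (i <= p)%N)).
Qed.

(** The hypothesis compares the mixed second differences of f_i h_j and a_i b_j. Summation by parts
    weights them by the corner sums of [1%:M - S], which are nonnegative. *)
Lemma doubly_stochastic_monge (R : realType) (n : nat) (S : 'M[R]_n.+1)
    (f h a b : 'rV[R]_n.+1) :
  doubly_stochastic S ->
  (forall p q, step f 0 p * step h 0 q <= step a 0 p * step b 0 q) ->
  (f *m (1%:M - S) *m h^T) 0 0 <= (a *m (1%:M - S) *m b^T) 0 0.
Proof.
move=> dS le_fa; have [_ Sr Sc] := dS.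
have rE i : \sum_j (1%:M - S) i j = 0.
  under eq_bigr do rewrite !mxE; rewrite sumrB Sr (bigD1 i) //= eqxx big1.
    by rewrite addr0 subrr.
  by move=> j; rewrite eq_sym => /negbTE ->.
have cE j : \sum_i (1%:M - S) i j = 0.
  under eq_bigr do rewrite !mxE; rewrite sumrB Sc (bigD1 j) //= eqxx big1.
    by rewrite addr0 subrr.
  by move=> i /negbTE ->.
rewrite !bilinear_step // !mxE; apply: ler_sum => q _.
rewrite !mxE !mulr_suml; apply: ler_sum => p _.
rewrite -!mulrA !(mulrCA (step _ 0 p)) ler_wpM2l ?initial_sums_ge0 //.
by have := le_fa p q; rewrite !mxE.
Qed.

(** Unit row and column sums turn the square terms into |x|^2 + |y|^2; the cross term is measured
    against its value at the identity matrix, which yields |x - y|^2. *)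
Lemma doubly_stochastic_cost (R : realType) (d : nat) (S : 'M[R]_d)
    (x y : 'rV[R]_d) :
  doubly_stochastic S ->
  \sum_i \sum_j (x 0 i - y 0 j) ^+ 2 * S i j =
  euclidean_norm (x - y) ^+ 2 + (x *m (1%:M - S) *m y^T) 0 0 *+ 2.
Proof.
move=> [_ Sr Sc].
rewrite sqr_sqrtr; last by apply: sumr_ge0 => i _; rewrite sqr_ge0.
have -> : \sum_i \sum_j (x 0 i - y 0 j) ^+ 2 * S i j =
    \sum_i x 0 i ^+ 2 + \sum_j y 0 j ^+ 2 - (x *m S *m y^T) 0 0 *+ 2.
  have -> : \sum_i x 0 i ^+ 2 = \sum_i \sum_j x 0 i ^+ 2 * S i j.
    by apply: eq_bigr => i _; rewrite -mulr_sumr Sr mulr1.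
  have -> : \sum_j y 0 j ^+ 2 = \sum_i \sum_j y 0 j ^+ 2 * S i j.
    by rewrite exchange_big; apply: eq_bigr => i _; rewrite -mulr_sumr Sc mulr1.
  have -> : (x *m S *m y^T) 0 0 = \sum_i \sum_j x 0 i * S i j * y 0 j.
    rewrite mxE exchange_big; apply: eq_bigr => j _.
    by rewrite !mxE mulr_suml.
  rewrite -sumrMnl -big_split -sumrB; apply: eq_bigr => i _ /=.
  rewrite -sumrMnl -big_split -sumrB; apply: eq_bigr => j _ /=; ring.
rewrite mulmxBr mulmx1 mulmxBl.
have -> : (x *m y^T - x *m S *m y^T) 0 0 =
    \sum_i x 0 i * y 0 i - (x *m S *m y^T) 0 0.
  by rewrite !mxE; congr (_ - _); apply: eq_bigr => i _; rewrite mxE.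
have -> : \sum_i (x - y) 0 i ^+ 2 =
    \sum_i x 0 i ^+ 2 + \sum_j y 0 j ^+ 2 - (\sum_i x 0 i * y 0 i) *+ 2.
  rewrite -sumrMnl -big_split -sumrB; apply: eq_bigr => i _ /=.
  by rewrite !mxE; ring.
ring.
Qed.

(** * The Euclidean norm and the Lipschitz constant *)

Lemma euclidean_norm_ge0 (R : realType) (d : nat) (x : 'rV[R]_d) :
  0 <= euclidean_norm x.
Proof. exact: sqrtr_ge0. Qed.

Lemma euclidean_norm_eq0 (R : realType) (d : nat) (x : 'rV[R]_d) :
  euclidean_norm x = 0 -> x = 0.
Proof.
move=> /eqP; rewrite sqrtr_eq0 => x0.
have s0 : \sum_i x 0 i ^+ 2 = 0.
  by apply/eqP; rewrite eq_le x0 sumr_ge0 // => i _; rewrite sqr_ge0.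
apply/rowP => i; rewrite mxE; apply/eqP; rewrite -sqrf_eq0; apply/eqP.
by apply: (psumr_eq0P _ s0) => // j _; rewrite sqr_ge0.
Qed.

Lemma euclidean_norm0 (R : realType) (d : nat) :
  euclidean_norm (0 : 'rV[R]_d) = 0.
Proof.
by rewrite /euclidean_norm big1 ?sqrtr0 // => i _; rewrite mxE expr0n.
Qed.

Lemma lip_const_ge0 (R : realType) (d : nat) (F : ordvec R d -> 'rV[R]_d) :
  0 <= lip_const F.
Proof.
rewrite /lip_const; set E := [set r | _]%classic.
(* [sup] takes the default value 0 on an empty or unbounded set; otherwise any quotient in the set
   shows that it is nonnegative. *)
have [hE|/sup_out ->//] := pselect (has_sup E).
have [[r Er] ubE] := hE; apply: le_trans (ub_le_sup ubE Er).
by case: Er => x [y [_ ->]]; rewrite divr_ge0 ?euclidean_norm_ge0.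
Qed.

Lemma lip_constP (R : realType) (d : nat) (F : ordvec R d -> 'rV[R]_d)
    (x y : ordvec R d) :
  lipschitz_continuous F ->
  euclidean_norm (F x - F y) <= lip_const F * euclidean_norm (val x - val y).
Proof.
move=> [K KF].
have [/val_inj ->|xy] := pselect (val x = val y).
  by rewrite !subrr !euclidean_norm0 mulr0.
have pos (u v : ordvec R d) : val u <> val v ->
    0 < euclidean_norm (val u - val v).
  move=> uv; rewrite lt_def euclidean_norm_ge0 andbT; apply/eqP.
  by move=> /euclidean_norm_eq0/eqP; rewrite subr_eq0 => /eqP.
rewrite -ler_pdivrMr ?pos //; apply: ub_le_sup; last by exists x, y.
by exists K => r [u [v [uv ->]]]; rewrite ler_pdivrMr ?pos.
Qed.

(** * Steps of [F x] against steps of [x] *)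

Lemma step_ge0 (R : realType) (n : nat) (x : ordvec R n.+1) p :
  0 <= step (val x) 0 p.
Proof.
rewrite mxE subr_ge0; have /nonincreasing_vecP := valP x; apply.
by rewrite /= /bump.
Qed.

(** Averaging entries p and p+1 moves [x] by its step divided by sqrt 2, and bounding a difference
    of two entries by the norm costs a factor sqrt 2; the two factors cancel. *)
Lemma step_lip (R : realType) (n : nat) (F : ordvec R n.+1 -> 'rV[R]_n.+1)
    (x : ordvec R n.+1) p :
  block_constant F -> lipschitz_continuous F ->
  `|step (F x) 0 p| <= lip_const F * step (val x) 0 p.
Proof.
move=> bF lF; pose i0 := widen_ord (leqnSn n) p; pose i1 := lift ord0 p.
have i01 : i1 != i0 by rewrite -val_eqE /= /bump /= add1n gtn_eqF.
pose m := (val x 0 i0 + val x 0 i1) / 2.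
pose y := \row_i if (i == i0) || (i == i1) then m else val x 0 i : R.
have /nonincreasing_vecP nx := valP x.
have sx := step_ge0 x p; rewrite mxE -/i0 -/i1 in sx.
have vi0 : i0 = p :> nat by [].
have vi1 : i1 = p.+1 :> nat by [].
have ny : nonincreasing_vec y.
  apply/nonincreasing_vecP => i j ij; rewrite !mxE.
  have m0 : m <= val x 0 i0 by rewrite /m; lra.
  have m1 : val x 0 i1 <= m by rewrite /m; lra.
  (* No index lies strictly between [i0] and [i1]: an entry kept from [x] comes before or after
     both, hence on the right side of the mean. *)
  have ltE (k : 'I_n.+1) : (k < i0)%N -> m <= val x 0 k.
    by move=> /ltnW/nx; apply: le_trans.
  have gtE (k : 'I_n.+1) : (i1 < k)%N -> val x 0 k <= m.
    by move=> /ltnW/nx /le_trans; apply.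
  rewrite -!(inj_eq (@ord_inj _)) vi0 vi1.
  case: ifP => hj; case: ifP => hi //; last exact: nx.
  - by apply: ltE; rewrite vi0; lia.
  - by apply: gtE; rewrite vi1; lia.
have sq_pair (u : 'rV[R]_n.+1) :
    \sum_i u 0 i ^+ 2 = u 0 i0 ^+ 2 + u 0 i1 ^+ 2 +
    \sum_(i | (i != i0) && (i != i1)) u 0 i ^+ 2.
  by rewrite (bigD1 i0) //= (bigD1 i1) //= addrA.
(* This is (s - t)^2 + (s + t)^2 = 2 (s^2 + t^2); the remaining squares only enlarge the norm. *)
have pair_le (u : 'rV[R]_n.+1) :
    (u 0 i0 - u 0 i1) ^+ 2 <= euclidean_norm u ^+ 2 *+ 2.
  rewrite sqr_sqrtr; last by apply: sumr_ge0 => i _; rewrite sqr_ge0.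
  rewrite sq_pair; set r := \sum_(_ | _) _.
  have : 0 <= r by apply: sumr_ge0 => i _; rewrite sqr_ge0.
  have := sqr_ge0 (u 0 i0 + u 0 i1); lra.
have xyE : euclidean_norm (val x - y) ^+ 2 *+ 2 = step (val x) 0 p ^+ 2.
  rewrite sqr_sqrtr; last by apply: sumr_ge0 => i _; rewrite sqr_ge0.
  rewrite sq_pair big1; last first.
    by move=> i /andP[/negbTE ni0 /negbTE ni1]; rewrite !mxE ni0 ni1 subrr expr0n.
  by rewrite !mxE !eqxx orbT /= -/i0 -/i1 /m; field.
pose Y : ordvec R n.+1 := exist _ y ny.
have FY : F Y 0 i0 = F Y 0 i1 by apply: bF; rewrite !mxE !eqxx orbT.
have -> : step (F x) 0 p = (F x - F Y) 0 i0 - (F x - F Y) 0 i1.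
  by rewrite !mxE FY -/i0 -/i1; ring.
rewrite -ler_sqr ?nnegrE ?mulr_ge0 ?lip_const_ge0 ?step_ge0 // real_normK ?num_real //.
rewrite exprMn -xyE mulrnAr -exprMn (le_trans (pair_le _)) // lerMn2r /=.
rewrite ler_sqr ?nnegrE ?mulr_ge0 ?euclidean_norm_ge0 ?lip_const_ge0 //.
exact: lip_constP.
Qed.

(** * The Frobenius norm and unitary matrices *)

Lemma frobenius_norm_ge0 (R : realType) (m n : nat) (A : 'M[R[i]]_(m, n)) :
  0 <= frobenius_norm A.
Proof. exact: sqrtr_ge0. Qed.

Lemma sqr_frobenius_norm (R : realType) (m n : nat) (A : 'M[R[i]]_(m, n)) :
  frobenius_norm A ^+ 2 = \sum_i \sum_j Normc.normc (A i j) ^+ 2.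
Proof.
rewrite sqr_sqrtr //; apply: sumr_ge0 => i _; apply: sumr_ge0 => j _.
exact: sqr_ge0.
Qed.

Lemma normc_sqrE (R : realType) (z : R[i]) :
  ((Normc.normc z ^+ 2)%:C = z * z^* )%C.
Proof. by rewrite rmorphXn /= -sqr_normc. Qed.

Lemma frobenius_norm_trace (R : realType) (m n : nat) (A : 'M[R[i]]_(m, n)) :
  ((frobenius_norm A ^+ 2)%:C)%C = \tr (A *m (A ^t*)%sesqui).
Proof.
rewrite sqr_frobenius_norm rmorph_sum; apply: eq_bigr => i _ /=.
rewrite rmorph_sum mxE; apply: eq_bigr => j _ /=.
by rewrite normc_sqrE !mxE.
Qed.

Lemma unitarymxPl (R : realType) (d : nat) (U : 'M[R[i]]_d) :
  U \is unitarymx -> (U ^t*)%sesqui *m U = 1%:M.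
Proof. by move=> uU; rewrite -invmx_unitary // mulVmx // unitarymx_unit. Qed.

(** Written as a trace, the squared norm sheds [V] by unitarity inside the product and [U] after a
    cyclic permutation. *)
Lemma frobenius_norm_unitary (R : realType) (d : nat) (U V A : 'M[R[i]]_d) :
  U \is unitarymx -> V \is unitarymx ->
  frobenius_norm ((U ^t*)%sesqui *m A *m V) = frobenius_norm A.
Proof.
move=> uU uV; apply/eqP; rewrite -(eqrXn2 (n := 2)) ?frobenius_norm_ge0 //.
apply/eqP; suff: forall x y : R, (x%:C = y%:C)%C -> x = y.
  apply; rewrite !frobenius_norm_trace !trmx_mul !map_mxM trmxCK !mulmxA.
  rewrite mulmxtVK // -!mulmxA mxtrace_mulC -!mulmxA.
  by move/unitarymxP: uU => ->; rewrite mulmx1.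
by move=> x y [].
Qed.

(** With ^H the conjugate transpose, row sums are the diagonal entries of W W^H = 1 and column sums
    those of W^H W = 1. *)
Lemma unitary_doubly_stochastic (R : realType) (d : nat) (W : 'M[R[i]]_d) :
  W \is unitarymx ->
  doubly_stochastic (\matrix_(i, j) Normc.normc (W i j) ^+ 2).
Proof.
move=> uW; split=> [i j|i|j]; first by rewrite mxE sqr_ge0.
- suff: (((\sum_j (\matrix_(i, j) Normc.normc (W i j) ^+ 2) i j)%:C)%C = 1)
    by case.
  have /unitarymxP/matrixP/(_ i i) := uW; rewrite !mxE eqxx => e; apply: etrans e.
  rewrite rmorph_sum; apply: eq_bigr => j _ /=.
  by rewrite mxE normc_sqrE !mxE.
- suff: (((\sum_i (\matrix_(i, j) Normc.normc (W i j) ^+ 2) i j)%:C)%C = 1)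
    by case.
  have /matrixP/(_ j j) := unitarymxPl uW; rewrite !mxE eqxx => e; apply: etrans e.
  rewrite rmorph_sum; apply: eq_bigr => i _ /=.
  by rewrite mxE normc_sqrE !mxE mulrC.
Qed.

(** Multiplying by U^H on the left and V on the right preserves the norm and turns the difference
    into D_x W - W D_y with W = U^H V, whose (i, j) entry is (x_i - y_j) W_ij. *)
Lemma frobenius_norm_spectral (R : realType) (d : nat) (U V : 'M[R[i]]_d)
    (x y : 'rV[R]_d) :
  U \is unitarymx -> V \is unitarymx ->
  frobenius_norm (U *m diagC x *m (U ^t*)%sesqui -
                  V *m diagC y *m (V ^t*)%sesqui) ^+ 2 =
  \sum_i \sum_j (x 0 i - y 0 j) ^+ 2 *
    (\matrix_(i, j) Normc.normc (((U ^t*)%sesqui *m V) i j) ^+ 2) i j.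
Proof.
move=> uU uV; rewrite -(frobenius_norm_unitary _ uU uV) sqr_frobenius_norm.
apply: eq_bigr => i _; apply: eq_bigr => j _.
rewrite mulmxBr mulmxBl !mulmxA unitarymxPl // mul1mx.
rewrite -(mulmxA _ (V ^t*)%sesqui V) unitarymxPl // mulmx1.
rewrite -(mulmxA (diagC x)).
rewrite /diagC mul_diag_mx mul_mx_diag; set W := _ *m V; clearbody W.
rewrite !mxE (mulrC (W i j)) -mulrBl -rmorphB.
rewrite Normc.normcM exprMn; congr (_ * _).
by rewrite /= expr0n /= addr0 sqr_sqrtr ?sqr_ge0.
Qed.

Theorem theorem3p3 (R : realType) (d : nat) (F : ordvec R d -> 'rV[R]_d)
    (hblock : block_constant F) (hlip : lipschitz_continuous F)
    (A B : 'M[R[i]]_d) (hA : A \is hermsymmx) (hB : B \is hermsymmx) :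
  frobenius_norm (spectral_lift F A - spectral_lift F B)
    <= lip_const F * frobenius_norm (A - B).
Proof.
have [U [a dA]] := spectral_decomposition_exists hA.
have [V [b dB]] := spectral_decomposition_exists hB.
rewrite (spectral_liftE hblock dA) (spectral_liftE hblock dB).
case: dA => uU ->; case: dB => uV ->.
rewrite -ler_sqr ?nnegrE ?mulr_ge0 ?frobenius_norm_ge0 ?lip_const_ge0 //.
have uW : (U ^t*)%sesqui *m V \is unitarymx.
  by apply: mul_unitarymx uV; rewrite trmxC_unitary.
have dS := unitary_doubly_stochastic uW.
(* The lift keeps [U] and [V], so one doubly stochastic matrix serves both [A - B] and the
   difference of the lifts. *)
have costE x y := etrans (frobenius_norm_spectral x y uU uV)
  (doubly_stochastic_cost x y dS).
rewrite [leRHS]exprMn [leLHS]costE [X in _ <= _ * X]costE.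
(* The norm terms compare by the Lipschitz bound at [a] and [b], the cross terms by the Monge
   argument. *)
rewrite mulrDr -exprMn lerD //.
  rewrite ler_sqr ?nnegrE ?mulr_ge0 ?euclidean_norm_ge0 ?lip_const_ge0 //.
  exact: lip_constP.
rewrite mulrnAr lerMn2r /=.
set S := (\matrix_(_, _) _) in dS *; clearbody S.
clear costE uW uU uV hA hB; clear U V A B.
(* Steps require a last entry, so dimension 0 is separate; the products are then empty sums. *)
case: d F hblock hlip a b S dS => [|n] F hblock hlip a b S dS.
  by rewrite !mxE !big_ord0 mulr0.
(* The squared constant is absorbed by scaling both eigenvalue vectors. *)
have -> : lip_const F ^+ 2 * (val a *m (1%:M - S) *m (val b)^T) 0 0 =
   ((lip_const F *: val a) *m (1%:M - S) *m (lip_const F *: val b)^T) 0 0.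
  by rewrite [(_ *: _)^T]linearZ /= -!scalemxAl -scalemxAr scalerA [RHS]mxE -expr2.
apply: doubly_stochastic_monge => // p q.
(* Steps of [F a] and [F b] may have either sign, so their product is bounded through absolute
   values. *)
rewrite (le_trans (ler_norm _)) // normrM.
have stepZ (x : 'rV[R]_n.+1) r : step (lip_const F *: x) 0 r =
    lip_const F * step x 0 r by rewrite !mxE mulrBr.
by rewrite !stepZ ler_pM ?normr_ge0 ?step_lip.
Qed.
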